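(* For every integer $k>1$ and every integer $n\ge 1$, the complete graph $K_n$ is a $k$-MSP graph.
   Context: All graphs are finite and simple. Polygons are simple polygons (closed planar regions without holes); angles equal to $\pi$ are not considered vertices. The direction of a line segment in the plane is the angle it makes with the $x$-axis. For an integer $k>1$, an allowed direction (with respect to $k$) is one in $\{ i\pi/k : 0\le i<k\}$. A $k$-lizard is a polygon all of whose sides have allowed directions with respect to $k$ (side lengths are arbitrary). A scale of a $k$-lizard $L$ is a maximal convex $k$-lizard contained in $L$: a convex $k$-lizard $S\subseteq L$ such that whenever $T$ is a convex $k$-lizard with $S\subseteq T\subseteq L$, $T=S$. A graph $G$ is a $k$-MSP graph if there exist a $k$-lizard $L$ and a bijection between the vertices of $G$ and the scales of $L$ such that two vertices of $G$ are adjacent if and only if the interiors of the corresponding scales intersect. *)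

(* Defs.v *)
From HB Require Import structures.
From mathcomp Require Import all_boot all_order all_algebra.
From mathcomp Require Import all_classical all_reals all_analysis.
Set Implicit Arguments.
Unset Strict Implicit.
Unset Printing Implicit Defensive.
Import Order.TTheory GRing.Theory Num.Theory.
Import numFieldNormedType.Exports.
Local Open Scope classical_set_scope.
Local Open Scope ring_scope.

(* [R^o] rather than [R], so that the product is a normed module over [R]. *)
Notation plane R := (R^o * R^o)%type.

Definition segment (R : realType) (u v : plane R) : set (plane R) :=
  [set u + t *: (v - u) | t in `[0, 1]].

(* A closed polygonal curve is given by its cyclic sequence of vertices:
   [vertex s i] is the [i]th one, indices being read modulo [size s]. *)
Definition vertex (R : realType) (s : seq (plane R)) (i : nat) : plane R :=
  nth 0 s (i %% size s)%N.

Definition side (R : realType) (s : seq (plane R)) (i : nat) : set (plane R) :=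
  segment (vertex s i) (vertex s i.+1).

Definition curve (R : realType) (s : seq (plane R)) : set (plane R) :=
  \bigcup_(i in `I_(size s)) side s i.

(* The last clause says that no angle is equal to pi; it also rules out sides
   of length zero. *)
Definition simple_curve (R : realType) (s : seq (plane R)) : Prop :=
  [/\ (3 <= size s)%N,
      forall i, (i < size s)%N ->
        side s i `&` side s i.+1 = [set vertex s i.+1],
      forall i j, (i < size s)%N -> (j < size s)%N -> i != j ->
        (j != i.+1 %[mod size s])%N -> (i != j.+1 %[mod size s])%N ->
        side s i `&` side s j = set0
    & forall i, (i < size s)%N ->
        ~ segment (vertex s i) (vertex s i.+2) (vertex s i.+1)].

(* The closed region bounded by the curve: the points enclosed by the curve
   are those whose component in the complement of the curve is bounded. *)
Definition region (R : realType) (s : seq (plane R)) : set (plane R) :=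
  curve s `|`
  [set x | (~` curve s) x /\
           bounded_set (connected_component (~` curve s) x)].

Definition has_direction (R : realType) (u v : plane R) (theta : R) : Prop :=
  exists2 l : R, l != 0 & v - u = (l * cos theta, l * sin theta).

Definition allowed_direction (R : realType) (k : nat) (theta : R) : Prop :=
  exists2 i : nat, (i < k)%N & theta = i%:R * pi / k%:R.

Definition lizard (R : realType) (k : nat) (L : set (plane R)) : Prop :=
  exists s : seq (plane R),
    [/\ simple_curve s,
        forall i, (i < size s)%N ->
          exists2 theta : R, allowed_direction k theta
                           & has_direction (vertex s i) (vertex s i.+1) theta
      & L = region s].

Definition convex_lizard (R : realType) (k : nat) (S : set (plane R)) : Prop :=
  lizard k S /\ convex_set S.

Definition scale (R : realType) (k : nat) (L S : set (plane R)) : Prop :=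
  [/\ convex_lizard k S, S `<=` L
    & forall T : set (plane R),
        convex_lizard k T -> S `<=` T -> T `<=` L -> T = S].

Record sgraph := SGraph {
  svertex :> finType;
  sedge : rel svertex;
  sedge_sym : symmetric sedge;
  sedge_irr : irreflexive sedge }.

Definition MSP_graph (R : realType) (k : nat) (G : sgraph) : Prop :=
  exists2 L : set (plane R), lizard k L &
  exists2 f : G -> set (plane R), set_bij [set: G] (scale k L) f &
    forall u v : G, u != v ->
      (sedge u v <-> (f u)° `&` (f v)° !=set0).

Lemma neq_sym (T : eqType) : symmetric (fun x y : T => x != y).
Proof. by move=> x y; rewrite eq_sym. Qed.

Lemma neq_irr (T : eqType) : irreflexive (fun x y : T => x != y).
Proof. by move=> x; rewrite eqxx. Qed.

Definition complete_graph (n : nat) : sgraph :=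
  SGraph (@neq_sym 'I_n) (@neq_irr 'I_n).

(* Main.v *)
(* In the oblique coordinates (u, v) along the directions 0 and pi - pi/k, every
   allowed direction has non-negative slope (or is vertical).  Hence a convex
   k-lizard T has no side with outward normal in the open first quadrant, and so
   contains the point (max u, max v) over T.  If T lies in a staircase, a union of
   n parallelograms [0, X_i] x [0, Y_(i+1)] with X decreasing and Y increasing,
   then the parallelogram containing that point contains all of T.  The scales of
   the staircase are therefore these n parallelograms, and they share a
   neighbourhood of a point near the origin. *)
Require Import Defs.
From mathcomp Require Import all_boot all_order all_algebra.
From mathcomp Require Import all_classical all_reals all_analysis.
From mathcomp Require Import zify ring lra.
Set Implicit Arguments.
Unset Strict Implicit.
Unset Printing Implicit Defensive.
Import Order.TTheory GRing.Theory Num.Theory.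
Import numFieldNormedType.Exports.
Local Open Scope classical_set_scope.
Local Open Scope ring_scope.

(** * Points enclosed by a polygonal curve *)

Section Region.
Variable R : realType.
Implicit Types (x u v d : plane R) (s : seq (plane R)) (p q M : R).

Lemma vertex_mod s i : vertex s (i %% size s) = vertex s i.
Proof. by rewrite /vertex modn_mod. Qed.

(** The ray is connected, so it stays in the component of its origin, yet it leaves every ball. *)
Lemma ray_unbounded (A : set (plane R)) x d : d != 0 ->
  (forall t : R, 0 <= t -> A (x + t *: d)) ->
  ~ bounded_set (connected_component A x).
Proof.
move=> d0 rA [M [_ MA]].
have dgt0 : 0 < `|d| by rewrite normr_gt0.
pose ray := (fun t : R => x + t *: d) @` `[0, +oo[.
have rayc : connected ray.
  apply: connected_continuous_connected.
    by apply/connected_intervalP; exact: interval_is_interval.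
  apply: continuous_subspaceT => t.
  by apply: cvgD; [exact: cvg_cst|apply: cvgZr_tmp; exact: cvg_id].
have ray0 : ray x.
  by exists 0; rewrite ?scale0r ?addr0 //= in_itv /= lexx.
have raysub : ray `<=` A.
  by move=> _ [t + <-]; rewrite /= in_itv /= andbT; exact: rA.
(* At this parameter [T *: d] has norm [|M| + 1 + |x|], so the point reached has norm at least
   [|M| + 1], beyond the bound [|M| + 1 / 2]. *)
pose T := (`|M| + 1 + `|x|) / `|d|.
have T0 : 0 <= T by rewrite divr_ge0 // addr_ge0 // addr_ge0.
have : `|x + T *: d| <= `|M| + 1 / 2.
  apply: MA; first by apply: (le_lt_trans (ler_norm M)); rewrite ltrDl.
  apply: (connected_component_max ray0 raysub rayc).
  by exists T => //=; rewrite in_itv /= T0.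
apply/negP; rewrite -ltNge.
have TE : `|T *: d| = `|M| + 1 + `|x|.
  by rewrite normrZ ger0_norm // /T divfK // gt_eqF.
have : `|T *: d| <= `|x + T *: d| + `|x|.
  by rewrite -{1}[T *: d](addKr x) addrC; apply: (le_trans (ler_normB _ _)).
rewrite TE; lra.
Qed.

Lemma region_ray s x d : d != 0 ->
  (forall t : R, 0 <= t -> ~ curve s (x + t *: d)) -> ~ region s x.
Proof.
move=> d0 rs [cx|[_]]; last exact: ray_unbounded d0 rs.
by apply: (rs 0 (lexx 0)); rewrite scale0r addr0.
Qed.

Lemma segment_linear p q u v x : segment u v x -> exists2 t : R, 0 <= t <= 1 &
  p * x.1 + q * x.2 =
  (1 - t) * (p * u.1 + q * u.2) + t * (p * v.1 + q * v.2) :> R.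
Proof.
move=> [t /=]; rewrite in_itv /= => t01 <-; exists t => //=.
by rewrite /GRing.scale /=; ring.
Qed.

Lemma curve_halfplane p q M s :
  (forall i, p * (vertex s i).1 + q * (vertex s i).2 <= M) ->
  forall x, curve s x -> p * x.1 + q * x.2 <= M.
Proof.
move=> sM x [i _ /(segment_linear p q) [t /andP[t0 t1] ->]].
by have := sM i; have := sM i.+1; nra.
Qed.

(* The ray from [x] in the direction [(p, q)] meets the curve at most at [x]. *)
Lemma region_support p q M s x : (p != 0) || (q != 0) ->
  (forall i, p * (vertex s i).1 + q * (vertex s i).2 <= M) ->
  region s x -> M <= p * x.1 + q * x.2 -> curve s x.
Proof.
move=> pq0 sM rx Mx; apply: contrapT => ncx.
have pq : 0 < p ^+ 2 + q ^+ 2.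
  by rewrite lt_def paddr_eq0 ?sqr_ge0 // !sqrf_eq0 negb_and pq0 addr_ge0 ?sqr_ge0.
suff: ~ region s x by [].
apply: (@region_ray _ _ ((p, q) : plane R)).
  by rewrite -pair_eqE /= negb_and.
move=> t t0; move: t0; rewrite le_eqVlt => /orP[/eqP <-|t0].
  by rewrite scale0r addr0.
move=> /(curve_halfplane sM) /=; rewrite /GRing.scale /=; nra.
Qed.

(** A point of the region at or beyond the supporting line is on the curve by [region_support], and
    the curve obeys the bound. *)
Lemma region_halfplane p q M s x : (p != 0) || (q != 0) ->
  (forall i, p * (vertex s i).1 + q * (vertex s i).2 <= M) ->
  region s x -> p * x.1 + q * x.2 <= M.
Proof.
move=> pq0 sM rx; case: (leP M (p * x.1 + q * x.2)) => [Mx|/ltW //].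
by apply: (curve_halfplane sM); apply: region_support Mx.
Qed.

Lemma curve_vertex s i : (0 < size s)%N -> curve s (vertex s i).
Proof.
move=> s0; rewrite -vertex_mod; exists (i %% size s)%N; first by rewrite /= ltn_mod.
by exists 0; rewrite ?scale0r ?addr0 //= in_itv /= lexx ler01.
Qed.

Lemma convex_segment (A : set (plane R)) u v :
  convex_set A -> A u -> A v -> segment u v `<=` A.
Proof.
move=> cA Au Av x [t]; rewrite /= in_itv /= => /andP[t0 t1] <-.
have t01 : Itv.spec (@Itv.num_sem R) (Itv.Real `[0%Z, 1%Z]) t.
  by rewrite /= /Itv.num_sem /= num_real in_itv /= t0 t1.
(* The weight [t] of [conv] goes to its first point, hence the order [v], [u]. *)
have := cA v u (Itv.mk t01); rewrite !inE => /(_ Av Au).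
rewrite /conv /=; congr A.
rewrite /unstable.onem scalerBr scalerBl scale1r addrC -addrA; congr (_ + _).
by rewrite addrC.
Qed.

End Region.

(** * The upper right corner of a convex lizard *)

Section Corner.
Variables (R : realType) (c h : R).
Hypothesis h0 : 0 < h.
Implicit Types (x u v : plane R) (s : seq (plane R)).

(* With [c = cos (pi / k)] and [h = sin (pi / k)], these are, up to scaling by
   [h], the coordinates in the basis of unit vectors of directions [0] and
   [pi - pi / k]. *)
Definition ucoord x : R := h * x.1 + c * x.2.
Definition vcoord x : R := x.2.

(* Pigeonhole: among [size s + 1] points of the segment, two lie on the same side
   of the curve, which then has the direction of the segment. *)
Lemma curve_no_decreasing_segment s u v :
  (forall i, (i < size s)%N ->
     0 <= (ucoord (vertex s i.+1) - ucoord (vertex s i)) *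
          (vcoord (vertex s i.+1) - vcoord (vertex s i))) ->
  (ucoord v - ucoord u) * (vcoord v - vcoord u) < 0 -> ~ segment u v `<=` curve s.
Proof.
move=> sides uv suv; set N := size s.
(* There are [N.+1] sample points for only [N] sides. *)
pose z (j : 'I_N.+1) : plane R := u + (j%:R / N.+1%:R : R) *: (v - u).
have sz j : exists i : 'I_N, side s i (z j).
  have [|i iN zi] := suv (z j); last by exists (Ordinal iN).
  exists (j%:R / N.+1%:R) => //=.
  by rewrite in_itv /= divr_ge0 //= ler_pdivrMr // mul1r ler_nat ltnW.
pose g j := projT1 (cid (sz j)).
have gP j : side s (g j) (z j) by rewrite /g; case: cid.
have /injectivePn [j1 [j2 j12 g12]] : ~~ injectiveb g.
  apply/injectiveP => /leq_card; rewrite !card_ord ltnn //.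
have [t1 _] := gP j1; have [t2 _] := gP j2; rewrite -g12.
have := sides (g j1) (ltn_ord _).
set b := vertex s _; set a := vertex s _.
move=> ab E2 E1.
pose r1 : R := j1%:R / N.+1%:R; pose r2 : R := j2%:R / N.+1%:R.
have r12 : r1 != r2.
  apply: contraNneq j12; rewrite /r1 /r2 => /divIf; rewrite pnatr_eq0.
  by move=> /(_ isT)/eqP; rewrite eqr_nat.
(* Both sample points lie on the segment and on one common side, so the gap in either coordinate can
   be computed in two ways. *)
have E (f : plane R -> R) : f = ucoord \/ f = vcoord ->
    (r2 - r1) * (f v - f u) = (t2 - t1) * (f b - f a).
  move=> fE; have [f1 f2] : f (z j1) = (1 - t1) * f a + t1 * f b /\
      f (z j2) = (1 - t2) * f a + t2 * f b.
    rewrite -E1 -E2; case: fE => ->;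
    by rewrite /ucoord /vcoord /= /GRing.scale /=; split; ring.
  have [f3 f4] : f (z j1) = (1 - r1) * f u + r1 * f v /\
      f (z j2) = (1 - r2) * f u + r2 * f v.
    rewrite /z -/r1 -/r2; case: fE => ->;
    by rewrite /ucoord /vcoord /= /GRing.scale /=; split; ring.
  rewrite f3 in f1; rewrite f4 in f2; lra.
have Ea := E ucoord (or_introl erefl); have Eb := E vcoord (or_intror erefl).
(* Multiplying the two identities compares the products of increments up to squares, the left one
   positive; the signs then contradict [uv]. *)
have : (r2 - r1) ^+ 2 * ((ucoord v - ucoord u) * (vcoord v - vcoord u)) =
       (t2 - t1) ^+ 2 * ((ucoord b - ucoord a) * (vcoord b - vcoord a)).
  by rewrite !expr2 mulrACA Ea Eb mulrACA.
have : 0 < (r2 - r1) ^+ 2 by rewrite lt_def sqr_ge0 sqrf_eq0 subr_eq0 eq_sym r12.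
have : 0 <= (t2 - t1) ^+ 2 by exact: sqr_ge0.
move=> t12 r0 EE.
have : 0 <= (t2 - t1) ^+ 2 * ((ucoord b - ucoord a) * (vcoord b - vcoord a)).
  exact: mulr_ge0.
by rewrite -EE leNgt pmulr_rlt0 // uv.
Qed.

(* [V i2] is the vertex maximizing [ucoord], then [vcoord].  If some vertex were
   higher, take [V w] such that the line from [V i2] to [V w] is closest to
   vertical: it supports the region, so by [region_support] and convexity the
   segment from [V i2] to [V w], of negative slope, is contained in the curve. *)
Lemma convex_region_corner s : (0 < size s)%N ->
  (forall i, (i < size s)%N ->
     0 <= (ucoord (vertex s i.+1) - ucoord (vertex s i)) *
          (vcoord (vertex s i.+1) - vcoord (vertex s i))) ->
  convex_set (region s) ->
  exists2 u, region s u &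
    forall x, region s x -> ucoord x <= ucoord u /\ vcoord x <= vcoord u.
Proof.
move=> s0 sides cs.
have hneq (b : R) : (h != 0) || (b != 0) by rewrite gt_eqF.
pose i0 := Ordinal s0; pose V (i : 'I_(size s)) := vertex s i.
have VP (P : plane R -> Prop) : (forall i, P (V i)) -> forall i, P (vertex s i).
  move=> PV i; rewrite -vertex_mod.
  by have := PV (Ordinal (ltn_pmod i s0)).
have rV i : region s (V i) by left; exact: curve_vertex.
have [i1 _ i1max] := @arg_maxP _ _ _ i0 xpredT (fun i => ucoord (V i)) isT.
have [i2 /eqP i2i1 i2max] := @arg_maxP _ _ _ i1
  [pred i | ucoord (V i) == ucoord (V i1)] (fun i => vcoord (V i)) (eqxx _).
have amax i : ucoord (V i) <= ucoord (V i2) by rewrite i2i1; exact: i1max.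
have bmax i : vcoord (V i) <= vcoord (V i2).
  rewrite leNgt; apply/negP => bi.
  have [w bw wmin] := @arg_minP _ _ _ i [pred i | vcoord (V i2) < vcoord (V i)]
      (fun i => (ucoord (V i2) - ucoord (V i)) / (vcoord (V i) - vcoord (V i2))) bi.
  rewrite /= in bw.
  have aw : ucoord (V w) < ucoord (V i2).
    rewrite lt_neqAle amax andbT; apply/eqP => aE.
    by have := i2max w; rewrite /= aE i2i1 eqxx => /(_ isT); rewrite leNgt bw.
  (* This weight makes [ucoord + l * vcoord] equal at [V i2] and [V w]; its level line through them
     is the supporting line. *)
  pose l := (ucoord (V i2) - ucoord (V w)) / (vcoord (V w) - vcoord (V i2)).
  have l0 : 0 < l by rewrite divr_gt0 // subr_gt0.
  have lw : ucoord (V w) + l * vcoord (V w) = ucoord (V i2) + l * vcoord (V i2).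
    have : l * (vcoord (V w) - vcoord (V i2)) = ucoord (V i2) - ucoord (V w).
      by rewrite /l divfK // subr_eq0 gt_eqF.
    lra.
  pose M := ucoord (V i2) + l * vcoord (V i2).
  have supp j : h * (vertex s j).1 + (c + l) * (vertex s j).2 <= M.
    suff : ucoord (vertex s j) + l * vcoord (vertex s j) <= M.
      by apply: le_trans; rewrite /ucoord /vcoord; lra.
    apply: (VP (fun v => ucoord v + l * vcoord v <= _)) => {}j; have := amax j.
    (* Vertices not above [V i2] are bounded in both coordinates; for the higher ones the bound is
       the minimality of [l]. *)
    case: (leP (vcoord (V j)) (vcoord (V i2))) => [bj aj|bj aj].
      by apply: lerD => //; rewrite ler_pM2l.
    have := wmin j bj; rewrite -/l ler_pdivlMr ?subr_gt0 // /M; lra.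
  apply: (@curve_no_decreasing_segment s (V i2) (V w)) => //.
    by rewrite nmulr_rlt0 ?subr_lt0 // subr_gt0.
  move=> x xseg; apply: (region_support (hneq (c + l)) supp).
    exact: (convex_segment cs (rV i2) (rV w)).
  have [t /andP[t0 t1] ->] := segment_linear h (c + l) xseg.
  have gE y : h * y.1 + (c + l) * y.2 = ucoord y + l * vcoord y.
    by rewrite /ucoord /vcoord; ring.
  by rewrite !gE lw /M; lra.
exists (V i2); first exact: rV.
move=> x rx; split.
  by apply: (@region_halfplane _ h c _ s) => //; exact: (VP (fun v => ucoord v <= _)).
(* The bound on [vcoord] is the half-plane bound for the linear form with coefficients 0 and 1. *)
have := @region_halfplane _ 0 1 (vcoord (V i2)) s x; rewrite oner_neq0 orbT => /(_ isT).
rewrite mul0r add0r mul1r; apply=> // i.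
by rewrite mul0r add0r mul1r; exact: (VP (fun v => vcoord v <= _)).
Qed.

End Corner.
Arguments ucoord : simpl never.
Arguments vcoord : simpl never.

(** * Oblique coordinates and segments parallel to their axes *)

Section Coordinates.
Variables (R : realType) (c h : R).
Hypothesis h0 : 0 < h.
Implicit Types (x u v d : plane R) (a b : R).
Notation U := (ucoord c h).

(** The inverse of the coordinate map: solve [h * x.1 + c * b = a] for [x.1]. *)
Definition uvpoint a b : plane R := ((a - c * b) / h, b).

Lemma ucoord_uvpoint a b : U (uvpoint a b) = a.
Proof. by rewrite /ucoord /= mulrC divfK ?gt_eqF // subrK. Qed.

Lemma vcoord_uvpoint a b : vcoord (uvpoint a b) = b. Proof. by []. Qed.

Lemma uvpointP x : uvpoint (U x) (vcoord x) = x.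
Proof.
case: x => x1 x2; rewrite /uvpoint /ucoord /vcoord /=; congr (_, _).
by rewrite addrK mulrC mulKf ?gt_eqF.
Qed.

Lemma ucoordD x d (t : R) : U (x + t *: d) = U x + t * U d.
Proof. by rewrite /ucoord /= /GRing.scale /=; ring. Qed.

Lemma vcoordD x d (t : R) : vcoord (x + t *: d) = vcoord x + t * vcoord d.
Proof. by []. Qed.

Lemma ucoord_continuous : continuous (U : plane R -> R^o).
Proof.
move=> x; apply: cvgD; apply: cvgM;
  by [exact: cvg_cst|exact: cvg_fst|exact: cvg_snd].
Qed.

Lemma vcoord_continuous : continuous (@vcoord R : plane R -> R^o).
Proof. by move=> x; exact: cvg_snd. Qed.

Lemma segmentC u v : segment u v = segment v u.
Proof.
have sub (u' v' : plane R) : segment u' v' `<=` segment v' u'.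
  move=> x [t]; rewrite /= in_itv /= => /andP[t0 t1] <-; exists (1 - t).
    by rewrite /= in_itv /=; lra.
  rewrite scalerBl scale1r scalerBr scalerBr addrA addrCA subrr addr0.
  by rewrite opprB addrC.
by apply/seteqP; split; exact: sub.
Qed.

Lemma uvcoord_inj x u : U x = U u -> vcoord x = vcoord u -> x = u.
Proof. by move=> ax bx; rewrite -(uvpointP x) -(uvpointP u) ax bx. Qed.

Lemma segment_uvcoord u v x : segment u v x <-> exists2 t : R, 0 <= t <= 1 &
  U x = U u + t * (U v - U u) /\ vcoord x = vcoord u + t * (vcoord v - vcoord u).
Proof.
split=> [[t]|[t t01 [ax bx]]].
  rewrite /= in_itv => t01 <-; exists t => //; rewrite ucoordD vcoordD; split => //.
  by rewrite /ucoord /=; ring.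
exists t; first by rewrite /= in_itv.
apply: uvcoord_inj; rewrite ?ucoordD ?vcoordD //.
by rewrite ax /ucoord /=; ring.
Qed.

(** As one coordinate is constant, the box spanned by the endpoints degenerates to the segment.
    Membership in a side of the staircase thus becomes a pair of interval conditions. *)
Lemma segment_uvpoint a b a' b' x : a' <= a -> b <= b' -> (a = a' \/ b = b') ->
  segment (uvpoint a b) (uvpoint a' b') x <-> (a' <= U x <= a) /\ (b <= vcoord x <= b').
Proof.
move=> aa bb ab; rewrite segment_uvcoord !ucoord_uvpoint !vcoord_uvpoint; split.
  move=> [t /andP[t0 t1] [-> ->]].
  by split; apply/andP; split; nra.
move=> [/andP[ax ax'] /andP[bx bx']].
case: ab => E; rewrite -E in aa bb ax bx' *.
- have ax0 : U x = a by apply/eqP; rewrite eq_le ax ax'.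
  have [bE|bn] := eqVneq b b'.
    exists 0; rewrite ?lexx ?ler01 // ax0 !mul0r !addr0; split=> //.
    by apply/eqP; rewrite eq_le bx bE bx'.
  have b0 : 0 < b' - b by rewrite subr_gt0 lt_neqAle bn.
  exists ((vcoord x - b) / (b' - b)).
    by rewrite divr_ge0 ?subr_ge0 //= ler_pdivrMr // mul1r lerD2r.
  by rewrite divfK ?gt_eqF // ax0 subrr mulr0 addr0 addrCA subrr addr0.
- have bx0 : vcoord x = b by apply/eqP; rewrite eq_le bx bx'.
  have [aE|an] := eqVneq a a'.
    exists 0; rewrite ?lexx ?ler01 // bx0 !mul0r !addr0; split=> //.
    by apply/eqP; rewrite eq_le ax' aE ax.
  have a0 : 0 < a - a' by rewrite subr_gt0 lt_neqAle eq_sym an.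
  exists ((a - U x) / (a - a')).
    by rewrite divr_ge0 ?subr_ge0 //= ler_pdivrMr // mul1r; lra.
  rewrite bx0 subrr mulr0 addr0; split => //.
  by rewrite -(opprB a a') mulrN divfK ?gt_eqF //; ring.
Qed.

(** [v] shares one coordinate with [u] and the other with [w]. A parameter [t] for [v] therefore
    kills one increment by the factor [t] and the other by [1 - t], which leaves [t = 0], [t = 1] or
    [u = w], and each makes [v] an endpoint. *)
Lemma turn_notin_segment u v w :
  (vcoord u = vcoord v /\ U v = U w) \/ (U u = U v /\ vcoord v = vcoord w) ->
  u != v -> v != w -> ~ segment u w v.
Proof.
move=> uvw uv vw /segment_uvcoord[t _ [at_ bt]].
have tE : t = 0 \/ t = 1 \/ u = w.
  case: uvw => [[buv avw]|[auv bvw]].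
  - have : (1 - t) * (U w - U u) = 0 by rewrite avw in at_; lra.
    have : t * (vcoord w - vcoord u) = 0 by rewrite -buv in bt; lra.
    move=> /eqP; rewrite mulf_eq0 subr_eq0 => /orP[/eqP|/eqP bE]; first by left.
    move=> /eqP; rewrite mulf_eq0 !subr_eq0 => /orP[/eqP|/eqP aE]; first by right; left.
    by right; right; apply: uvcoord_inj.
  - have : (1 - t) * (vcoord w - vcoord u) = 0 by rewrite bvw in bt; lra.
    have : t * (U w - U u) = 0 by rewrite -auv in at_; lra.
    move=> /eqP; rewrite mulf_eq0 subr_eq0 => /orP[/eqP|/eqP bE]; first by left.
    move=> /eqP; rewrite mulf_eq0 !subr_eq0 => /orP[/eqP|/eqP aE]; first by right; left.
    by right; right; apply: uvcoord_inj.
case: tE => [t0|[t1|uw]].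
- by case/eqP: uv; apply: uvcoord_inj; rewrite ?at_ ?bt t0; ring.
- by case/eqP: vw; apply: uvcoord_inj; rewrite ?at_ ?bt t1; ring.
- by case/eqP: uv; apply: uvcoord_inj; rewrite ?at_ ?bt uw; ring.
Qed.

End Coordinates.

(** * Staircases *)

Section Stair.
Variables (R : realType) (c h : R).
Hypothesis h0 : 0 < h.
Notation U := (ucoord c h).
Notation P := (uvpoint c h).
Variables (X Y : nat -> R) (m : nat).
Hypothesis m0 : (0 < m)%N.
Hypothesis ltX : forall i j, (i < j)%N -> X j < X i.
Hypothesis ltY : forall i j, (i < j)%N -> Y i < Y j.
Hypothesis Xm : X m = 0.
Hypothesis Y0 : Y 0%N = 0.
Implicit Type x : plane R.

Let leX i j : (i <= j)%N -> X j <= X i.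
Proof. by rewrite leq_eqVlt => /orP[/eqP->//|/ltX/ltW]. Qed.

Let leY i j : (i <= j)%N -> Y i <= Y j.
Proof. by rewrite leq_eqVlt => /orP[/eqP->//|/ltY/ltW]. Qed.

Let ltX_lt i j : X j < X i -> (i < j)%N.
Proof. by case: (leqP j i) => // /leX; rewrite leNgt => /negbTE->. Qed.

Let ltY_lt i j : Y i < Y j -> (i < j)%N.
Proof. by case: (leqP j i) => // /leY; rewrite leNgt => /negbTE->. Qed.

(* The origin, then [(X 0, Y 0)], [(X 0, Y 1)], [(X 1, Y 1)], [(X 1, Y 2)], and so
   on up to [(X m, Y m)], where [X m = Y 0 = 0]. *)
Definition stair_vertex (j : nat) : plane R :=
  if j is k.+1 then P (X k./2) (Y k.+1./2) else P 0 0.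

Definition stair : seq (plane R) := mkseq stair_vertex m.+1.*2.

Lemma size_stair : size stair = m.+1.*2. Proof. exact: size_mkseq. Qed.

Lemma vertex_stair i : vertex stair i = stair_vertex (i %% m.+1.*2).
Proof. by rewrite /vertex size_stair nth_mkseq // ltn_mod doubleS. Qed.

Lemma vertex_stair_small i : (i < m.+1.*2)%N -> vertex stair i = stair_vertex i.
Proof. by move=> im; rewrite vertex_stair modn_small. Qed.

Lemma vertex_stair_size : vertex stair m.+1.*2 = P 0 0.
Proof. by rewrite vertex_stair modnn. Qed.

Lemma side_stair_first x :
  side stair 0 x <-> (0 <= U x <= X 0%N) /\ vcoord x = 0.
Proof.
have X0 : 0 <= X 0%N by rewrite -Xm leX.
rewrite /side !vertex_stair_small ?doubleS //= segmentC Y0.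
rewrite segment_uvpoint //; last by right.
split=> [[-> bx]|[-> ->]]; last by rewrite lexx.
by split=> //; apply/le_anti; rewrite andbC.
Qed.

Lemma side_stair_last x :
  side stair m.*2.+1 x <-> U x = 0 /\ (0 <= vcoord x <= Y m).
Proof.
have Ym : 0 <= Y m by rewrite -Y0 leY.
rewrite /side vertex_stair_small ?doubleS //= -doubleS vertex_stair_size.
rewrite segmentC doubleK uphalf_double Xm.
rewrite segment_uvpoint //; last by left.
split=> [[ax ->]|[-> ->]]; last by rewrite lexx.
by split=> //; apply/le_anti; rewrite andbC.
Qed.

(** One formula covers both kinds of side: the [ucoord] interval is a point for even [k], the
    [vcoord] interval for odd [k]. *)
Lemma side_stair_mid k x : (k < m.*2)%N ->
  side stair k.+1 x <->
  (X k.+1./2 <= U x <= X k./2) /\ (Y k.+1./2 <= vcoord x <= Y k.+2./2).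
Proof.
move=> km; rewrite /side !vertex_stair_small ?doubleS ?ltnS //; last by lia.
rewrite [stair_vertex _]/= segment_uvpoint //.
- by apply: leX; lia.
- by apply: leY; lia.
- have [ok|ek] := boolP (odd k).
    by right; congr Y; lia.
  by left; congr X; lia.
Qed.

Lemma stair_side_cases i : (i < m.+1.*2)%N ->
  [\/ i = 0%N, i = m.*2.+1 | exists2 k, (k < m.*2)%N & i = k.+1].
Proof.
case: i => [|k]; first by move=> _; constructor 1.
rewrite doubleS !ltnS leq_eqVlt => /orP[/eqP->|km]; first by constructor 2.
by constructor 3; exists k.
Qed.

Lemma stair_edge i : if odd i
  then U (vertex stair i) = U (vertex stair i.+1) /\
       vcoord (vertex stair i) != vcoord (vertex stair i.+1)
  else vcoord (vertex stair i) = vcoord (vertex stair i.+1) /\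
       U (vertex stair i) != U (vertex stair i.+1).
Proof.
(* The number of sides is even, so reducing the index modulo it keeps the parity. *)
wlog im : i / (i < m.+1.*2)%N => [wlg|].
  have im : (i %% m.+1.*2 < m.+1.*2)%N by rewrite ltn_mod doubleS.
  have := wlg _ im; rewrite odd_mod ?odd_double //.
  by rewrite !vertex_stair modn_mod -(addn1 (i %% _)) modnDml addn1.
case: (stair_side_cases im) => [->|->|[k km ->]] /=.
- rewrite !vertex_stair_small ?doubleS //= !vcoord_uvpoint.
  rewrite !(ucoord_uvpoint _ h0) Y0; split => //.
  by rewrite -Xm lt_eqF // ltX.
- rewrite odd_double /= vertex_stair_small ?doubleS // -doubleS vertex_stair_size.
  rewrite /= doubleK uphalf_double !vcoord_uvpoint !(ucoord_uvpoint _ h0) Xm -Y0.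
  split => //.
  by rewrite gt_eqF // ltY.
- rewrite !vertex_stair_small ?doubleS ?ltnS //; last by lia.
  rewrite /stair_vertex !vcoord_uvpoint !(ucoord_uvpoint _ h0).
  case: ifPn => ok; split.
  + by congr X; lia.
  + by rewrite lt_eqF // ltY //; lia.
  + by congr Y; lia.
  + by rewrite gt_eqF // ltX //; lia.
Qed.

Lemma stair_vertex_neq i : vertex stair i != vertex stair i.+1.
Proof.
apply/eqP => E; have := stair_edge i.
by case: ifP => _ []; rewrite E // => _; rewrite eqxx.
Qed.

Lemma stair_turn i :
  ~ segment (vertex stair i) (vertex stair i.+2) (vertex stair i.+1).
Proof.
apply: (@turn_notin_segment _ c _ h0); [|exact: stair_vertex_neq..].
have := stair_edge i; have := stair_edge i.+1; rewrite /=.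
by case: (odd i) => /= -[E1 _] [E2 _]; [right|left].
Qed.

Lemma side_stair_size : side stair m.+1.*2 = side stair 0.
Proof. by rewrite /side !vertex_stair modnn -addn1 modnDl mod0n. Qed.

Lemma stair_adjacent i : (i < m.+1.*2)%N ->
  side stair i `&` side stair i.+1 = [set vertex stair i.+1].
Proof.
move=> im; apply/seteqP; split=> [x [x1 x2]|_ ->]; last first.
  split; [exists 1|exists 0]; rewrite ?scale1r ?scale0r ?addr0 ?subrKC //=;
    by rewrite in_itv /= ?lexx ?ler01.
rewrite /=; move: x1 x2; case: (stair_side_cases im) => [->|->|[k km ->]].
- rewrite side_stair_first side_stair_mid ?double_gt0 //.
  rewrite vertex_stair_small ?doubleS //= => -[/andP[_ a1] b1] [/andP[a2 _] _].
  by apply: (@uvcoord_inj _ c _ h0); 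
    rewrite ?(ucoord_uvpoint _ h0) ?vcoord_uvpoint ?b1 ?Y0 //; apply/le_anti/andP.
- rewrite -doubleS side_stair_size vertex_stair_size.
  rewrite side_stair_first side_stair_last => -[a1 _] [_ b2].
  by apply: (@uvcoord_inj _ c _ h0); rewrite ?(ucoord_uvpoint _ h0) ?vcoord_uvpoint.
- rewrite side_stair_mid // vertex_stair_small; last by lia.
  (* In the first case the next side is the last one, which returns to the origin and has its own
     description. *)
  have [kE0|km1] := eqVneq k.+1 m.*2.
    rewrite [in side _ _.+2]kE0 side_stair_last => -[_ /andP[b1 b2]] [a2 _].
    have kE : (k.+2./2 = m)%N by lia.
    have kE1 : (k.+1./2 = m)%N by lia.
    apply: (@uvcoord_inj _ c _ h0);
      rewrite ?(ucoord_uvpoint _ h0) ?vcoord_uvpoint ?a2 ?kE1 ?Xm //.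
    by rewrite kE1 in b1; rewrite kE in b2 *; apply/le_anti/andP.
  rewrite side_stair_mid; last by lia.
  move=> [/andP[a1 _] /andP[_ b1]] [/andP[_ a2] /andP[b2 _]].
  by apply: (@uvcoord_inj _ c _ h0);
    rewrite ?(ucoord_uvpoint _ h0) ?vcoord_uvpoint; apply/le_anti/andP.
Qed.

Lemma stair_nonadjacent i j : (i.+1 < j < m.+1.*2)%N ->
  ~~ ((i == 0) && (j == m.*2.+1))%N ->
  side stair i `&` side stair j = set0.
Proof.
move=> /andP[ij jm] ij0; rewrite -subset0 => x [].
have Xpos i1 : (i1 < m)%N -> 0 < X i1 by rewrite -Xm; exact: ltX.
have Ypos i1 : (0 < i1)%N -> 0 < Y i1 by rewrite -Y0; exact: ltY.
have im : (i < m.+1.*2)%N by lia.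
case: (stair_side_cases im) => [iE|iE|[k km iE]]; [|lia|];
  (case: (stair_side_cases jm) => [jE|jE|[l lm jE]]; [lia| |]); subst i j.
- by rewrite !eqxx in ij0.
- rewrite side_stair_first side_stair_mid // => -[_ bx] [_ /andP[bx1 _]].
  by move: bx1; rewrite bx leNgt Ypos //; lia.
- rewrite side_stair_last side_stair_mid // => -[/andP[ax1 _] _] [ax _].
  by move: ax1; rewrite ax leNgt Xpos //; lia.
- rewrite !side_stair_mid // => -[/andP[a1 _] /andP[_ b1]] [/andP[_ a2] /andP[b2 _]].
  (* As [k.+1 < l], one of the half-indices jumps strictly, which separates the intervals in that
     coordinate. *)
  have [kl|kl] : (k.+1./2 < l./2 \/ k.+2./2 < l.+1./2)%N by lia.
    by have := le_trans a1 a2; rewrite leNgt ltX.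
  by have := le_trans b2 b1; rewrite leNgt ltY.
Qed.

Lemma stair_simple : simple_curve stair.
Proof.
split; rewrite ?size_stair.
- by rewrite doubleS; lia.
- exact: stair_adjacent.
- move=> i j im jm ij ij1 ji1.
  wlog lij : i j im jm ij ij1 ji1 / (i < j)%N => [wlg|].
    case: (ltngtP i j) => [|ji|ijE]; first exact: wlg.
      by rewrite setIC; apply: wlg; rewrite // eq_sym.
    by rewrite ijE eqxx in ij.
  apply: stair_nonadjacent.
    rewrite jm andbT ltn_neqAle lij andbT; apply: contraNneq ij1 => ->.
    by rewrite eqxx.
  apply: contraNN ji1 => /andP[/eqP -> /eqP ->].
  by rewrite -doubleS modnn mod0n.
- by move=> i _; exact: stair_turn.
Qed.

(** * The region enclosed by the staircase curve *)

Definition stair_set : set (plane R) :=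
  [set x | 0 <= U x /\ 0 <= vcoord x /\
    exists2 i, (i < m)%N & U x <= X i /\ vcoord x <= Y i.+1].

(** Strict inequalities for one common [i], so that exactly the curve is missing from [stair_set],
    as the next lemmas show. *)
Definition stair_interior : set (plane R) :=
  [set x | 0 < U x /\ 0 < vcoord x /\
    exists2 i, (i < m)%N & U x < X i /\ vcoord x < Y i.+1].

Lemma stair_interior_sub : stair_interior `<=` stair_set.
Proof.
move=> x [/ltW a0 [/ltW b0 [i im [/ltW ai /ltW bi]]]].
by split=> //; split=> //; exists i.
Qed.

Lemma stair_curve_sub : curve stair `<=` stair_set `\` stair_interior.
Proof.
move=> x [i im]; have {}im : (i < m.+1.*2)%N by rewrite -size_stair.
case: (stair_side_cases im) => [->|->|[k km ->]].
- rewrite side_stair_first => -[/andP[a0 a1] bx]; split.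
    rewrite /stair_set /= bx lexx; split=> //; split=> //.
    by exists 0%N; rewrite // -Y0 leY.
  by move=> [_ [+ _]]; rewrite bx ltxx.
- rewrite side_stair_last => -[ax /andP[b0 b1]]; split; last first.
    by move=> [+ _]; rewrite ax ltxx.
  rewrite /stair_set /= ax lexx; split=> //; split=> //; exists m.-1; first by lia.
  by rewrite prednK // -Xm leX ?leq_pred.
- rewrite side_stair_mid // => -[/andP[a0 a1] /andP[b0 b1]]; split.
    split; first by apply: le_trans a0; rewrite -Xm leX //; lia.
    split; first by apply: le_trans b0; rewrite -Y0 leY.
    by exists k./2; [lia|].
  move=> [_ [_ [j jm [aj bj]]]].
  (* The two comparisons give [j < k.+1./2] and [k.+1./2 < j.+1], which are incompatible. *)
  have := ltX_lt (le_lt_trans a0 aj); have := ltY_lt (le_lt_trans b0 bj); lia.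
Qed.

Lemma stair_boundary_sub : stair_set `\` stair_interior `<=` curve stair.
Proof.
move=> x [[a0 [b0 [i im [ai bi]]]] nx].
have [bx0|bn0] := eqVneq (vcoord x) 0.
  exists 0%N; first by rewrite size_stair /= doubleS.
  by rewrite side_stair_first bx0 a0 (le_trans ai) // leX.
have [ax0|an0] := eqVneq (U x) 0.
  exists m.*2.+1; first by rewrite size_stair /= doubleS.
  by rewrite side_stair_last ax0 b0 (le_trans bi) // leY.
have bp : 0 < vcoord x by rewrite lt_def bn0.
have ap : 0 < U x by rewrite lt_def an0.
(* Away from the axes, the largest [j] with [U x <= X j] puts [U x] between [X j.+1] and [X j]. As
   [x] is not in [stair_interior], it lies on the slanted side [j.*2.+1] or on the horizontal side
   [j.*2.+2]. *)
have exP : exists j, (j < m)%N && (U x <= X j) by exists i; rewrite im.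
have bdP j : (j < m)%N && (U x <= X j) -> (j <= m)%N by case/andP=> /ltnW.
case: (ex_maxnP exP bdP) => j /andP[jm aj] jmax.
have bj : vcoord x <= Y j.+1.
  by apply: (le_trans bi); apply: leY; rewrite ltnS; apply: jmax; rewrite im.
have Xj1 : X j.+1 <= U x.
  rewrite leNgt; apply/negP => aj1.
  have [j1m|mj1] := ltnP j.+1 m.
    by have := jmax j.+1; rewrite j1m (ltW aj1) ltnn => /(_ isT).
  have jE : j.+1 = m by lia.
  by move: aj1; rewrite jE Xm ltNge a0.
have jm2 : (j.*2.+1 < m.*2)%N by rewrite -doubleS leq_double.
have [ajE|ajn] := eqVneq (U x) (X j).
- exists j.*2.+1; first by rewrite size_stair /= doubleS; do 2!apply: ltnW.
  rewrite side_stair_mid; last exact: ltnW.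
  rewrite /= uphalf_double doubleK ajE lexx bj; split=> //.
  rewrite andbT; case: j ajE {jmax jm2 Xj1 aj bj} jm => [|p] ajE jm.
    by rewrite Y0.
  (* Below [Y p.+1], the point would be strictly inside the preceding step [p], because
     [X p.+1 < X p]. *)
  rewrite leNgt; apply/negP => bp1; apply: nx; split=> //; split=> //.
  by exists p; [lia|split; rewrite // ajE ltX].
- have ajl : U x < X j by rewrite lt_neqAle ajn.
  have bjE : vcoord x = Y j.+1.
    apply/eqP; rewrite eq_le bj leNgt; apply/negP => bj1.
    by apply: nx; split=> //; split=> //; exists j.
  exists j.*2.+2; first by rewrite size_stair /= -doubleS ltn_double.
  rewrite side_stair_mid //.
  by rewrite /= doubleK uphalf_double bjE lexx Xj1 aj.
Qed.

Lemma stair_interior_open : open stair_interior.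
Proof.
have -> : stair_interior = (U @^-1` [set a : R^o | 0 < a]) `&`
    ((@vcoord R) @^-1` [set b : R^o | 0 < b]) `&`
    \bigcup_(i in `I_m) ((U @^-1` [set a : R^o | a < X i]) `&`
      ((@vcoord R) @^-1` [set b : R^o | b < Y i.+1])).
  apply/seteqP; split=> [x [a0 [b0 [i im ?]]]|x [[a0 b0] [i im ?]]].
    by split=> //; exists i.
  by split=> //; split=> //; exists i.
apply: openI; first apply: openI.
- by apply: open_comp; [move=> x _; exact: ucoord_continuous|exact: open_gt].
- by apply: open_comp; [move=> x _; exact: vcoord_continuous|exact: open_gt].
- apply: bigcup_open => i _; apply: openI.
    by apply: open_comp; [move=> x _; exact: ucoord_continuous|exact: open_lt].
  by apply: open_comp; [move=> x _; exact: vcoord_continuous|exact: open_lt].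
Qed.

Lemma stair_set_closed : closed stair_set.
Proof.
have -> : stair_set = (U @^-1` [set a : R^o | 0 <= a]) `&`
    ((@vcoord R) @^-1` [set b : R^o | 0 <= b]) `&`
    \bigcup_(i in `I_m) ((U @^-1` [set a : R^o | a <= X i]) `&`
      ((@vcoord R) @^-1` [set b : R^o | b <= Y i.+1])).
  apply/seteqP; split=> [x [a0 [b0 [i im ?]]]|x [[a0 b0] [i im ?]]].
    by split=> //; exists i.
  by split=> //; split=> //; exists i.
apply: closedI; first apply: closedI.
- by apply: preimage_closed; [move=> x _; exact: ucoord_continuous|exact: closed_ge].
- by apply: preimage_closed; [move=> x _; exact: vcoord_continuous|exact: closed_ge].
- apply: closed_bigcup => // i _; apply: closedI.
    by apply: preimage_closed; [move=> x _; exact: ucoord_continuous|exact: closed_le].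
  by apply: preimage_closed; [move=> x _; exact: vcoord_continuous|exact: closed_le].
Qed.

Lemma stair_set_bounded : bounded_set stair_set.
Proof.
exists ((X 0%N + `|c| * Y m) / h + Y m); split; first exact: num_real.
move=> N /ltW MN x [a0 [b0 [i im [ai bi]]]] /=; apply: le_trans MN.
have aX : U x <= X 0%N by apply: le_trans ai _; exact: leX.
have bY : vcoord x <= Y m by apply: le_trans bi _; exact: leY.
have M0 : 0 <= (X 0%N + `|c| * Y m) / h.
  apply: divr_ge0; last exact: ltW.
  apply: addr_ge0; first exact: le_trans a0 aX.
  by apply: mulr_ge0 => //; exact: le_trans b0 bY.
rewrite prod_normE ge_max; apply/andP; split; last first.
  by rewrite ger0_norm //; apply: (le_trans bY); rewrite lerDr.
apply: (@le_trans _ _ ((X 0%N + `|c| * Y m) / h)); last first.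
  by rewrite lerDl (le_trans b0 bY).
have -> : x.1 = (U x - c * vcoord x) / h by rewrite -{1}(uvpointP c h0 x).
rewrite normrM [`|h^-1|]ger0_norm ?invr_ge0 ?(ltW h0) // ler_pM2r ?invr_gt0 //.
apply: (le_trans (ler_normB _ _)).
rewrite normrM [`|U x|]ger0_norm // [`|vcoord x|]ger0_norm //.
by apply: lerD => //; rewrite ler_wpM2l.
Qed.

(** If a coordinate is negative, decrease it further. Otherwise increase both: a point of
    [stair_set] on that ray would force [x] into the same step. *)
Lemma stair_set_ray x : ~ stair_set x ->
  exists2 d : plane R, d != 0 &
    forall t : R, 0 <= t -> ~ stair_set (x + t *: d).
Proof.
move=> nx.
have dn a b : (a != 0) || (b != 0) -> P a b != 0.
  apply: contraTneq => E.
  have := ucoord_uvpoint c h0 a b; have := vcoord_uvpoint c h a b.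
  by rewrite E /vcoord /ucoord /= !mulr0 addr0 => <- <-; rewrite eqxx.
have [an|a0] := ltP (U x) 0.
  exists (P (-1) 0); first by rewrite dn // oppr_eq0 oner_eq0.
  by move=> t t0 [+ _]; rewrite ucoordD ucoord_uvpoint //; lra.
have [bn|b0] := ltP (vcoord x) 0.
  exists (P 0 (-1)); first by rewrite dn // oppr_eq0 oner_eq0 orbT.
  by move=> t t0 [_ [+ _]]; rewrite vcoordD vcoord_uvpoint; lra.
exists (P 1 1); first by rewrite dn // oner_eq0.
move=> t t0 [_ [_ [i im]]].
rewrite ucoordD vcoordD ucoord_uvpoint // vcoord_uvpoint => -[ai bi].
by apply: nx; split=> //; split=> //; exists i => //; lra.
Qed.

(** Points outside [stair_set] escape along a ray that avoids the curve. For the converse,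
    [stair_interior] is open, and relative to the complement of the curve it is also closed, being
    the trace of [stair_set]. It therefore contains the component of each of its points, which is
    then bounded. *)
Lemma region_stair : region stair = stair_set.
Proof.
apply/seteqP; split=> x.
  move=> rx; apply: contrapT => /stair_set_ray[d d0 dP].
  by apply: (region_ray d0 _ rx) => t /dP nt /stair_curve_sub[].
move=> Cx; have [Ux|nUx] := pselect (stair_interior x); last first.
  by left; apply: stair_boundary_sub.
have CU : stair_set `&` ~` curve stair = stair_interior.
  apply/seteqP; split=> y.
    by move=> [Cy ncy]; apply: contrapT => nUy; apply: ncy; exact: stair_boundary_sub.
  by move=> Uy; split; [exact: stair_interior_sub|move=> /stair_curve_sub[]].
have ncx : (~` curve stair) x by rewrite -CU in Ux; case: Ux.
right; split=> //; set K := connected_component _ _.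
have KE : K `&` stair_interior = K.
  apply: (component_connected (A := ~` curve stair) (x := x)).
  - by exists x; split => //; exact: connected_component_refl.
  - by exists stair_interior => //; exact: stair_interior_open.
  - exists stair_set; first exact: stair_set_closed.
    rewrite -CU (setIC stair_set) setIA; congr (_ `&` _).
    by apply/setIidPl; exact: connected_component_sub.
rewrite -KE; have [M [Mr MP]] := stair_set_bounded.
exists M; split=> // N MN y [_ /stair_interior_sub]; exact: MP.
Qed.

End Stair.

(** * Lizards and scales *)

Section Lizards.
Variables (R : realType) (k : nat).
Hypothesis k1 : (1 < k)%N.
Let phi : R := pi / k%:R.
Let c := cos phi.
Let h := sin phi.
Notation U := (ucoord c h).
Notation P := (uvpoint c h).
Implicit Types (x u v : plane R) (theta a b : R).

Let kR0 : 0 < k%:R :> R.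
Proof. by rewrite ltr0n ltnW. Qed.

Let h0 : 0 < h.
Proof.
apply: sin_gt0_pi; rewrite divr_gt0 ?pi_gt0 //=.
by rewrite ltr_pdivrMr // ltr_pMr ?pi_gt0 // ltr1n.
Qed.

(** Along direction [t = i * pi / k] the coordinates change by [l * sin (t + phi)] and [l * sin t].
    Since [i < k], both angles lie between 0 and [pi], so the two sines are non-negative. *)
Lemma allowed_sides_monotone u v theta : allowed_direction k theta ->
  has_direction u v theta -> 0 <= (U v - U u) * (vcoord v - vcoord u).
Proof.
move=> [i ik ->] [l _]; set t := i%:R * pi / k%:R => E.
have tphi : t + phi = i.+1%:R * pi / k%:R by rewrite -natr1 mulrDl mul1r mulrDl.
have piR : 0 < pi :> R := pi_gt0 R.
have le_pi j : (j <= k)%N -> 0 <= (j%:R * pi / k%:R : R) <= pi.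
  move=> jk; rewrite divr_ge0 ?mulr_ge0 ?ler0n ?(ltW piR) //=.
  by rewrite ler_pdivrMr // mulrC ler_pM2l // ler_nat.
have -> : U v - U u = l * sin (t + phi).
  have -> : U v - U u = h * (v - u).1 + c * (v - u).2 by rewrite /ucoord /=; ring.
  by rewrite E sinD -/c -/h /=; ring.
have -> : vcoord v - vcoord u = l * sin t by have := congr1 snd E.
have : 0 <= sin (t + phi) by apply: sin_ge0_pi; rewrite tphi; exact: le_pi.
have : 0 <= sin t by apply: sin_ge0_pi; apply: le_pi; exact: ltnW.
move=> s1 s2; rewrite mulrACA -expr2; apply: mulr_ge0; first exact: sqr_ge0.
exact: mulr_ge0.
Qed.

Lemma convex_lizard_corner T : convex_lizard k T ->
  exists2 u, T u & forall x, T x -> U x <= U u /\ vcoord x <= vcoord u.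
Proof.
move=> [[s [[s3 _ _ _] sdir ->]] cT].
apply: convex_region_corner => //; first exact: leq_trans s3.
by move=> i /sdir[th ath hth]; exact: allowed_sides_monotone ath hth.
Qed.

Lemma horizontal_direction u v : vcoord u = vcoord v -> U u != U v ->
  exists2 theta : R, allowed_direction k theta & has_direction u v theta.
Proof.
move=> buv auv; exists 0.
  by exists 0%N; [exact: ltnW|rewrite mul0r mul0r].
have E : U v - U u = h * (v.1 - u.1) by move: buv; rewrite /ucoord /vcoord => ->; ring.
exists (v.1 - u.1).
  by apply: contraNneq auv => E0; rewrite eq_sym -subr_eq0 E E0 mulr0.
rewrite cos0 sin0 mulr1 mulr0; congr (_, _).
by rewrite /= (_ : v.2 = u.2) ?subrr.
Qed.

Lemma slanted_direction u v : U u = U v -> vcoord u != vcoord v ->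
  exists2 theta : R, allowed_direction k theta & has_direction u v theta.
Proof.
move=> auv buv; exists (pi - phi).
  (* The last allowed direction, [(k - 1) * pi / k], is [pi - phi]. *)
  exists k.-1; first by rewrite prednK // ltnW.
  by rewrite -subn1 natrB ?(ltnW k1) // /phi; field; rewrite gt_eqF.
exists ((vcoord v - vcoord u) / h).
  by apply: mulf_neq0; [rewrite subr_eq0 eq_sym|rewrite invr_eq0 gt_eqF].
rewrite cosB sinB cospi sinpi -/c -/h; congr (_, _) => /=; last first.
  by rewrite -[LHS]/(vcoord v - vcoord u); field; rewrite gt_eqF.
have E : h * (v.1 - u.1) = - c * (vcoord v - vcoord u).
  by move: auv; rewrite /ucoord /vcoord; lra.
apply: (mulfI (lt0r_neq0 h0)); rewrite [LHS]E.
by field; rewrite gt_eqF.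
Qed.

Lemma stair_lizard (X Y : nat -> R) m : (0 < m)%N ->
  (forall i j, (i < j)%N -> X j < X i) -> (forall i j, (i < j)%N -> Y i < Y j) ->
  X m = 0 -> Y 0%N = 0 -> lizard k (stair_set c h X Y m).
Proof.
move=> m0 ltX ltY Xm Y0; exists (stair c h X Y m); split.
- exact: stair_simple.
- move=> i _; have := stair_edge c h0 m0 ltX ltY Xm Y0 i.
  by case: ifP => _ []; [exact: slanted_direction|exact: horizontal_direction].
- by rewrite region_stair.
Qed.

(** * Parallelograms as one-step staircases *)

Definition parallelogram a b : set (plane R) :=
  [set x | 0 <= U x <= a /\ 0 <= vcoord x <= b].

(** Linear sequences through [X1 a 0 = a], [X1 a 1 = 0], [Y1 b 0 = 0], [Y1 b 1 = b]: they are
    strictly monotone, so the staircase lemmas apply with [m = 1]. *)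
Let X1 a i : R := a * (1 - i%:R).
Let Y1 b i : R := b * i%:R.

Let ltX1 a i j : 0 < a -> (i < j)%N -> X1 a j < X1 a i.
Proof. by move=> a0 ij; rewrite ltr_pM2l // ltrD2l ltrN2 ltr_nat. Qed.

Let ltY1 b i j : 0 < b -> (i < j)%N -> Y1 b i < Y1 b j.
Proof. by move=> b0 ij; rewrite ltr_pM2l // ltr_nat. Qed.

Let parallelogramE a b : parallelogram a b = stair_set c h (X1 a) (Y1 b) 1.
Proof.
rewrite /X1 /Y1; apply/seteqP; split=> [x [/andP[? ?] /andP[? ?]]|x [? [? [i]]]].
  by split=> //; split=> //; exists 0%N; rewrite // subr0 !mulr1.
rewrite ltnS leqn0 => /eqP -> []; rewrite subr0 !mulr1 => ? ?.
by split; apply/andP.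
Qed.

Lemma parallelogram_lizard a b : 0 < a -> 0 < b ->
  convex_lizard k (parallelogram a b).
Proof.
move=> a0 b0; split.
  rewrite parallelogramE; apply: stair_lizard => //.
  - by move=> i j; exact: ltX1.
  - by move=> i j; exact: ltY1.
  - by rewrite /X1 subrr mulr0.
  - by rewrite /Y1 mulr0.
have avg_itv (t p q d : R) : 0 <= t -> t <= 1 -> 0 <= p <= d -> 0 <= q <= d ->
    0 <= t * p + (1 - t) * q <= d.
  by move=> t0 t1 /andP[p0 pd] /andP[q0 qd]; apply/andP; split; nra.
move=> x y l; rewrite !inE => -[ax bx] [ay by_].
set t := l%:num; have t0 : 0 <= t := ge0 l; have t1 : t <= 1 := le1 l.
have alE : U (conv l x y) = t * U x + (1 - t) * U y.
  by rewrite /ucoord /conv /= /GRing.scale /= -/t /unstable.onem; ring.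
have beE : vcoord (conv l x y) = t * vcoord x + (1 - t) * vcoord y by [].
by split; rewrite ?alE ?beE; apply: avg_itv;
  first [exact: t0|exact: t1|exact: ax|exact: ay|exact: bx|exact: by_].
Qed.

Lemma parallelogram_sub a b a' b' : 0 <= a -> 0 <= b ->
  parallelogram a b `<=` parallelogram a' b' -> a <= a' /\ b <= b'.
Proof.
(* The upper right corner of the smaller parallelogram carries both inequalities. *)
move=> a0 b0 /(_ (P a b)); rewrite /parallelogram /=.
rewrite ucoord_uvpoint // vcoord_uvpoint !lexx a0 b0.
by move=> /(_ (conj isT isT)) [/andP[_ ->] /andP[_ ->]].
Qed.

Lemma parallelogram_interior a b a' b' : 0 < a' < a -> 0 < b' < b ->
  (parallelogram a b)° (P a' b').
Proof.
move=> /andP[a'0 a'a] /andP[b'0 b'b].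
rewrite parallelogramE; apply: (filterS (@stair_interior_sub _ c h _ _ _)).
apply: open_nbhs_nbhs; split; first exact: stair_interior_open.
split; first by rewrite ucoord_uvpoint.
split; first by rewrite vcoord_uvpoint.
by exists 0%N => //; rewrite ucoord_uvpoint // vcoord_uvpoint /X1 /Y1 subr0 !mulr1.
Qed.

(** * The scales of the staircase *)

Section Staircase.
Variables (X Y : nat -> R) (m : nat).
Hypothesis m0 : (0 < m)%N.
Hypothesis ltX : forall i j, (i < j)%N -> X j < X i.
Hypothesis ltY : forall i j, (i < j)%N -> Y i < Y j.
Hypothesis Xm : X m = 0.
Hypothesis Y0 : Y 0%N = 0.

Definition step (i : 'I_m) := parallelogram (X i) (Y i.+1).

Let X_gt0 (i : 'I_m) : 0 < X i.
Proof. by rewrite -Xm ltX. Qed.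

Let Y_gt0 (i : 'I_m) : 0 < Y i.+1.
Proof. by rewrite -Y0 ltY. Qed.

Lemma step_sub_stair i : step i `<=` stair_set c h X Y m.
Proof.
by move=> x [/andP[? ?] /andP[? ?]]; split=> //; split=> //; exists i.
Qed.

(** Inclusion compares both widths and heights; as [X] decreases while [Y] increases, these give
    opposite inequalities between the indices. *)
Lemma step_inj i j : step i `<=` step j -> i = j.
Proof.
move=> /(parallelogram_sub (ltW (X_gt0 i)) (ltW (Y_gt0 i)))[Xij Yij].
apply/val_inj/eqP; rewrite eqn_leq /=; apply/andP; split; rewrite leqNgt.
  by apply/negP => /(@ltY j.+1 i.+1); rewrite ltNge Yij.
by apply/negP => /ltX; rewrite ltNge Xij.
Qed.

Lemma convex_lizard_sub_step T : convex_lizard k T -> T `<=` stair_set c h X Y m ->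
  exists i, T `<=` step i.
Proof.
move=> /convex_lizard_corner[u Tu umax] TL.
have [_ [_ [i im [ui vi]]]] := TL _ Tu.
exists (Ordinal im) => x Tx; have [xu xv] := umax _ Tx.
have [a0 [b0 _]] := TL _ Tx.
by split; apply/andP; split; rewrite //; [exact: le_trans ui|exact: le_trans vi].
Qed.

Lemma step_scale i : scale k (stair_set c h X Y m) (step i).
Proof.
split; [exact: parallelogram_lizard|exact: step_sub_stair|].
move=> T cT iT TL; have [j Tj] := convex_lizard_sub_step cT TL.
have ij : i = j by apply: step_inj; exact: subset_trans Tj.
by apply/seteqP; split => //; rewrite ij.
Qed.

Lemma scale_step S : scale k (stair_set c h X Y m) S -> exists i, step i = S.
Proof.
move=> [cS SL Smax]; have [i Si] := convex_lizard_sub_step cS SL.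
exists i; apply: Smax => //; last exact: step_sub_stair.
exact: parallelogram_lizard.
Qed.

Lemma step_interior_meet i j : (step i)° `&` (step j)° !=set0.
Proof.
have mX : 0 < Num.min (X i) (X j) by rewrite lt_min !X_gt0.
have mY : 0 < Num.min (Y i.+1) (Y j.+1) by rewrite lt_min !Y_gt0.
(* Half the smaller width and half the smaller height are strictly inside both parallelograms. *)
exists (P (Num.min (X i) (X j) / 2) (Num.min (Y i.+1) (Y j.+1) / 2)).
have min_le (a b : R) : Num.min a b <= a /\ Num.min a b <= b.
  by rewrite !ge_min !lexx orbT.
have [? ?] := min_le (X i) (X j); have [? ?] := min_le (Y i.+1) (Y j.+1).
by split; apply: parallelogram_interior; apply/andP; split; lra.
Qed.

Lemma complete_graph_MSP : MSP_graph R k (complete_graph m).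
Proof.
exists (stair_set c h X Y m); first exact: stair_lizard.
exists step; last first.
  by move=> i j ij; split=> _; [exact: step_interior_meet|exact: ij].
split.
- by move=> i _; exact: step_scale.
- by move=> i j _ _ E; apply: step_inj; rewrite E.
- by move=> S /scale_step[i <-]; exists i.
Qed.

End Staircase.
End Lizards.

Theorem proposition3p1 (R : realType) (k n : nat) :
  (1 < k)%N -> (1 <= n)%N -> MSP_graph R k (complete_graph n).
Proof.
move=> k1 n1.
(* Unit steps: [n - i] decreases to 0 at [i = n], and [i] increases from 0. *)
apply: (@complete_graph_MSP R k k1 (fun i => n%:R - i%:R) (fun i => i%:R)) => //.
- by move=> i j ij; rewrite ltrD2l ltrN2 ltr_nat.
- by move=> i j ij; rewrite ltr_nat.
- by rewrite subrr.
Qed.
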